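(* Let $\Lambda=kQ/I$ be a bound quiver algebra and let $\Lambda^*=kQ^*/I^*$ be its uniformization. The following statements hold. (i) An element $w\in kQ^*$ is in $I^*$ if and only if $w_{\mathrm{not}\,B}\in I$ and every path occurring in $w_B$ is divided by a path from $T_{\mathrm u}$. In particular, $I^*\cap kQ=I$. (ii) The Loewy length of $\Lambda^*$ is uniform and equal to the Loewy length of $\Lambda$. (iii) The inclusion $Q\hookrightarrow Q^*$, sending each vertex and arrow of $Q$ to itself, induces an injective algebra homomorphism $\iota\colon\Lambda\hookrightarrow\Lambda^*$. Similarly, the projection $Q^*\to Q$, sending each vertex and arrow of $Q$ to itself and every loop in $B$ to zero, induces a surjective algebra homomorphism $\pi\colon\Lambda^*\to\Lambda$. Moreover, $\pi\iota=\mathrm{id}_\Lambda$.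
   Context: A bound quiver algebra is $\Lambda=kQ/I$ with $k$ a field, $Q$ a finite quiver and $I$ an admissible ideal of $kQ$. For paths $p,q$, $pq$ denotes $p$ followed by $q$; $e_i$ is the trivial path at vertex $i$. The Loewy length of a left $\Lambda$-module $M$ is the least $t\ge0$ with $J(\Lambda)^tM=0$ ($J(\Lambda)$ the Jacobson radical), and the Loewy length of $\Lambda$ is that of ${}_\Lambda\Lambda$. The Loewy length of an algebra is uniform (from the left) if every indecomposable direct summand of its left regular module has Loewy length equal to that of the algebra. Uniformization: let $l$ be the Loewy length of $\Lambda$ and label the vertices $1,\dots,n$ so that $\Lambda e_i$ has Loewy length $l$ if and only if $m<i\le n$, where $0\le m<n$. Let $Q^*$ be the quiver obtained from $Q$ by adding one extra loop $\ell_i\colon i\to i$ for each vertex $i\le m$, and set $B=\{\ell_i\mid 1\le i\le m\}$. Let $$T_{\mathrm u}=\{\ell_i^{\,l},\ \gamma\ell_i,\ \ell_i\delta\mid i=1,\dots,m\},$$ where $\gamma$ ranges over the arrows of $Q$ with target $i$ and $\delta$ over the arrows of $Q$ with source $i$. Let $I^*$ be the ideal of $kQ^*$ generated by $I$ and $T_{\mathrm u}$ (with $kQ\subseteq kQ^*$), and $\Lambda^*=kQ^*/I^*$. A path occurs in an element of the path algebra if its coefficient in that element is nonzero. A path $p$ is divided by a path $q$ if $p=p_1qp_2$ for some paths $p_1,p_2$ (possibly trivial). For $w\in kQ^*$, write uniquely $w=w_B+w_{\mathrm{not}\,B}$, where $w_B$ is a $k$-linear combination of paths divided by at least one loop in $B$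 and $w_{\mathrm{not}\,B}$ is a $k$-linear combination of paths avoiding all loops in $B$ (so $w_{\mathrm{not}\,B}\in kQ$). *)

(* Defs.v *)
From HB Require Import structures.
From mathcomp Require Import all_boot all_order all_algebra.
From mathcomp Require Import finmap monalg.
From mathcomp Require Import boolp classical_sets.

Set Implicit Arguments.
Unset Strict Implicit.
Unset Printing Implicit Defensive.

Import GRing.Theory.

Local Open Scope classical_set_scope.
Local Open Scope ring_scope.

Definition is_ideal (A : pzRingType) (I : set A) : Prop :=
  [/\ I 0,
      forall x y, I x -> I y -> I (x + y) &
      forall a b x, I x -> I (a * x * b)].

Record ideal (A : pzRingType) := Ideal {
  ideal_set :> set A;
  ideal_setP : is_ideal ideal_set
}.

Section GeneratedIdeal.
Variables (A : pzRingType) (S : set A).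

Definition gen_ideal_set : set A :=
  [set x | forall J : ideal A, S `<=` J -> ideal_set J x].

Lemma gen_ideal_subproof : is_ideal gen_ideal_set.
Proof.
split=> [J _|x y Ix Iy J SJ|a b x Ix J SJ]; case: (ideal_setP J) => J0 JD JM //.
- by apply: JD; [apply: Ix|apply: Iy].
- by apply: JM; apply: Ix.
Qed.

Definition gen_ideal : ideal A := Ideal gen_ideal_subproof.
End GeneratedIdeal.

Section ProductOfSets.
Variable A : pzRingType.

Definition set_mul (X Y : set A) : set A :=
  [set x | exists s : seq (A * A),
     (forall u, u \in s -> X u.1 /\ Y u.2) /\ x = \sum_(u <- s) u.1 * u.2].

Definition set_exp (X : set A) (t : nat) : set A := iter t (set_mul X) setT.
End ProductOfSets.

Definition ideal_mem (A : pzRingType) (I : ideal A) : {pred A} :=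
  fun x => `[< ideal_set I x >].

Section IdealMem.
Variables (A : pzRingType) (I : ideal A).

Lemma ideal_memP x : reflect (ideal_set I x) (x \in ideal_mem I).
Proof. exact: asboolP. Qed.

Lemma ideal_mem_zmod_closed : zmod_closed (ideal_mem I).
Proof.
case: (ideal_setP I) => I0 ID IM.
split=> [|x y /ideal_memP Ix /ideal_memP Iy]; first exact/ideal_memP.
apply/ideal_memP; apply: ID => //.
by have := IM (-1) 1 y Iy; rewrite mulr1 mulN1r.
Qed.

HB.instance Definition _ :=
  GRing.isZmodClosed.Build A (ideal_mem I) ideal_mem_zmod_closed.

Lemma ideal_mem_mull a x : x \in ideal_mem I -> a * x \in ideal_mem I.
Proof.
case: (ideal_setP I) => _ _ IM /ideal_memP Ix; apply/ideal_memP.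
by have := IM a 1 x Ix; rewrite mulr1.
Qed.

Lemma ideal_mem_mulr a x : x \in ideal_mem I -> x * a \in ideal_mem I.
Proof.
case: (ideal_setP I) => _ _ IM /ideal_memP Ix; apply/ideal_memP.
by have := IM 1 a x Ix; rewrite mul1r.
Qed.
End IdealMem.

Section Modules.
Variables (R : pzRingType) (M : lmodType R).
Implicit Types N : set M.

Definition is_submodule N : Prop :=
  N 0 /\ forall (a : R) x y, N x -> N y -> N (a *: x + y).

Definition is_direct_sum N1 N2 N : Prop :=
  [/\ is_submodule N1, is_submodule N2, N1 `&` N2 = [set 0] &
      N = [set x + y | x in N1 & y in N2]].

Definition is_direct_summand N : Prop := exists N', is_direct_sum N N' setT.

Definition is_indecomposable N : Prop :=
  [/\ is_submodule N, N <> [set 0] &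
      forall N1 N2, is_direct_sum N1 N2 N -> N1 = [set 0] \/ N2 = [set 0]].

Definition is_maximal_submodule N : Prop :=
  [/\ is_submodule N, N <> setT &
      forall N', is_submodule N' -> N `<=` N' -> N' = N \/ N' = setT].
End Modules.

Definition jacobson (R : pzRingType) : set R :=
  [set x | forall L : set R^o, is_maximal_submodule L -> L x].

Section LoewyLength.
Variables (R : pzRingType) (M : lmodType R).

Definition kills (X : set R) (N : set M) : Prop :=
  forall a x, X a -> N x -> a *: x = 0.

Definition is_loewy_length (N : set M) (t : nat) : Prop :=
  kills (set_exp (jacobson (R:=R)) t) N /\
  forall s, kills (set_exp (jacobson (R:=R)) s) N -> (t <= s)%N.
End LoewyLength.

Definition is_alg_loewy_length (R : pzRingType) (t : nat) : Prop :=
  is_loewy_length [set: R^o] t.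

Definition uniform_loewy_length (R : pzRingType) : Prop :=
  exists2 t, is_alg_loewy_length R t &
    forall N : set R^o, is_direct_summand N -> is_indecomposable N ->
      is_loewy_length N t.

Record quiver := Quiver {
  vertex : finType;
  arrow : finType;
  source : arrow -> vertex;
  target : arrow -> vertex
}.

Section Paths.
Variable Q : quiver.

Fixpoint is_walk (v : vertex Q) (s : seq (arrow Q)) : bool :=
  if s is a :: s' then (source a == v) && is_walk (target a) s' else true.

Definition walk_end (v : vertex Q) (s : seq (arrow Q)) : vertex Q :=
  last v (map (@target Q) s).

Lemma is_walk_cat v s1 s2 :
  is_walk v (s1 ++ s2) = is_walk v s1 && is_walk (walk_end v s1) s2.
Proof. by elim: s1 v => //= a s1 IH v; rewrite IH andbA. Qed.

Lemma walk_end_cat v s1 s2 :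
  walk_end v (s1 ++ s2) = walk_end (walk_end v s1) s2.
Proof. by rewrite /walk_end map_cat last_cat. Qed.

Record qpath := QPath {
  qpath_data : vertex Q * seq (arrow Q);
  qpath_walk : is_walk qpath_data.1 qpath_data.2
}.

HB.instance Definition _ := [isSub for qpath_data].
HB.instance Definition _ := [Choice of qpath by <:].

Definition pstart (p : qpath) : vertex Q := (qpath_data p).1.
Definition parrows (p : qpath) : seq (arrow Q) := (qpath_data p).2.
Definition pend (p : qpath) : vertex Q := walk_end (pstart p) (parrows p).

Lemma trivial_path_walk (i : vertex Q) : is_walk i [::].
Proof. by []. Qed.
Definition trivial_path (i : vertex Q) : qpath :=
  @QPath (i, [::]) (trivial_path_walk i).

Lemma arrow_path_walk (a : arrow Q) : is_walk (source a) [:: a].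
Proof. by rewrite /= eqxx. Qed.
Definition arrow_path (a : arrow Q) : qpath :=
  @QPath (source a, [:: a]) (arrow_path_walk a).

Definition pcomp (p q : qpath) : option qpath :=
  if pend p == pstart q then insub (pstart p, parrows p ++ parrows q) else None.

Definition divides (q p : qpath) : Prop :=
  exists p1 p2, obind (fun u => pcomp u p2) (pcomp p1 q) = Some p.

Lemma qpathP (p q : qpath) :
  pstart p = pstart q -> parrows p = parrows q -> p = q.
Proof.
move=> s a; apply/val_inj => /=.
by rewrite [LHS]surjective_pairing [RHS]surjective_pairing -/(pstart p)
  -/(parrows p) s a.
Qed.

Lemma pcompP (p q r : qpath) :
  pcomp p q = Some r <->
  [/\ pend p = pstart q, pstart r = pstart p &
      parrows r = parrows p ++ parrows q].
Proof.
rewrite /pcomp; case: eqP => [e|ne]; last by split=> // -[].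
split=> [|[_ s a]].
  case: insubP => //= u _ eu [<-]; split=> //; by rewrite /pstart /parrows eu.
case: insubP => [u _ eu|].
  by congr Some; apply: qpathP; rewrite ?s ?a /pstart /parrows eu.
case/negP; rewrite /= is_walk_cat (qpath_walk p) /=.
by move: e; rewrite /pend => ->; apply: (qpath_walk q).
Qed.

Lemma pcompN (p q : qpath) : pend p <> pstart q -> pcomp p q = None.
Proof. by rewrite /pcomp => /eqP/negPf->. Qed.

Lemma pcomp_ex (p q : qpath) : pend p = pstart q -> exists r, pcomp p q = Some r.
Proof.
move=> e; case E: (pcomp p q) => [r|]; first by exists r.
move: E; rewrite /pcomp e eqxx; case: insubP => //.
case/negP; rewrite /= is_walk_cat (qpath_walk p) /=.
by move: e; rewrite /pend => ->; apply: (qpath_walk q).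
Qed.

Lemma pcomp_end (p q r : qpath) : pcomp p q = Some r -> pend r = pend q.
Proof.
by case/pcompP; rewrite /pend => e s a; rewrite s a walk_end_cat e.
Qed.

Lemma pcompA (p q r : qpath) :
  obind (pcomp p) (pcomp q r) = obind (fun u => pcomp u r) (pcomp p q).
Proof.
have [e1|n1] := pselect (pend p = pstart q); last first.
  rewrite (pcompN n1) /=; case E: (pcomp q r) => [u|] //=.
  by apply: pcompN; case/pcompP: E => _ ->.
have [u Eu] := pcomp_ex e1; rewrite Eu /=.
have [e2|n2] := pselect (pend q = pstart r); last first.
  by rewrite (pcompN n2) /= pcompN // (pcomp_end Eu).
have [v Ev] := pcomp_ex e2; rewrite Ev /=.
have [_ su au] := (pcompP _ _ _).1 Eu; have [_ sv av] := (pcompP _ _ _).1 Ev.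
have e3 : pend u = pstart r by rewrite (pcomp_end Eu).
have [w Ew] := pcomp_ex e3; rewrite Ew.
have [_ sw aw] := (pcompP _ _ _).1 Ew.
by apply/pcompP; rewrite sv sw aw av au su catA.
Qed.

Lemma pcomp1p (p : qpath) i :
  pcomp (trivial_path i) p = if i == pstart p then Some p else None.
Proof.
case: eqP => [e|ne]; last exact: pcompN.
by apply/pcompP; split=> //; rewrite -e.
Qed.

Lemma pcompp1 (p : qpath) i :
  pcomp p (trivial_path i) = if pend p == i then Some p else None.
Proof.
case: eqP => [e|ne]; last exact: pcompN.
by apply/pcompP; split=> //; rewrite cats0.
Qed.
End Paths.

Definition path_algebra (k : fieldType) (Q : quiver) : Type :=
  {malg k[qpath Q]}.

HB.instance Definition _ (k : fieldType) (Q : quiver) :=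
  GRing.Lmodule.copy (path_algebra k Q) {malg k[qpath Q]}.

HB.lock Definition path_elt (k : fieldType) (Q : quiver) (p : qpath Q) :
  path_algebra k Q := << 1 *g p >>.

Definition opath_elt (k : fieldType) (Q : quiver) (o : option (qpath Q)) :
  path_algebra k Q := oapp (@path_elt k Q) 0 o.

HB.lock Definition pathalg_mul (k : fieldType) (Q : quiver)
    (x y : path_algebra k Q) : path_algebra k Q :=
  \sum_(p <- msupp x) \sum_(q <- msupp y)
     (x@_p * y@_q) *: opath_elt k (pcomp p q).

Section PathAlgebra.
Variables (k : fieldType) (Q : quiver).
Local Notation kQ := (path_algebra k Q).
Local Notation path_elt := (@path_elt k Q).
Local Notation opath_elt := (@opath_elt k Q).
Local Notation pathalg_mul := (@pathalg_mul k Q).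

Definition pathalg_one : kQ := \sum_(i : vertex Q) path_elt (trivial_path i).

Lemma pathalg_mulw (dx dy : {fset qpath Q}) (x y : kQ) :
  (msupp x `<=` dx)%fset -> (msupp y `<=` dy)%fset ->
  pathalg_mul x y =
  \sum_(p <- dx) \sum_(q <- dy) (x@_p * y@_q) *: opath_elt (pcomp p q).
Proof.
move=> lex ley; rewrite pathalg_mul.unlock (big_fset_incl _ lex) /=.
  apply: eq_bigr => p _; apply: big_fset_incl => // q _ /mcoeff_outdom ->.
  by rewrite mulr0 scale0r.
move=> p _ /mcoeff_outdom ->.
by rewrite big1 // => q _; rewrite mul0r scale0r.
Qed.

Lemma pathalg_mul_path p q :
  pathalg_mul (path_elt p) (path_elt q) = opath_elt (pcomp p q).
Proof.
rewrite path_elt.unlock.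
rewrite (pathalg_mulw msuppU_le msuppU_le) !big_seq_fset1 !mcoeffUU.
by rewrite mulr1 scale1r.
Qed.

Lemma path_eltZ (c : k) p : c *: path_elt p = << c *g p >>.
Proof.
apply/malgP => q; rewrite path_elt.unlock (mcoeffZ c).
by rewrite [X in _ * X]mcoeffU [RHS]mcoeffU mulrnAr mulr1.
Qed.

Lemma pathalgE (x : kQ) : x = \sum_(p <- msupp x) x@_p *: path_elt p.
Proof.
rewrite {1}[x]monalgE; apply: eq_bigr => p _; rewrite path_eltZ.
by [].
Qed.


Lemma pathalg_mulDl : left_distributive pathalg_mul +%R.
Proof.
move=> x1 x2 y.
rewrite (pathalg_mulw (msuppD_le _ _) (fsubset_refl _)).
rewrite (pathalg_mulw (fsubsetUl _ (msupp x2)) (fsubset_refl _)).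
rewrite (pathalg_mulw (fsubsetUr (msupp x1) _) (fsubset_refl _)).
rewrite -big_split; apply: eq_bigr => p _ /=.
rewrite -big_split; apply: eq_bigr => q _ /=.
by rewrite mcoeffD mulrDl scalerDl.
Qed.

Lemma pathalg_mulDr : right_distributive pathalg_mul +%R.
Proof.
move=> x y1 y2.
rewrite (pathalg_mulw (fsubset_refl _) (msuppD_le _ _)).
rewrite (pathalg_mulw (fsubset_refl _) (fsubsetUl _ (msupp y2))).
rewrite (pathalg_mulw (fsubset_refl _) (fsubsetUr (msupp y1) _)).
rewrite -big_split; apply: eq_bigr => p _ /=.
rewrite -big_split; apply: eq_bigr => q _ /=.
by rewrite mcoeffD mulrDr scalerDl.
Qed.

Lemma pathalg_mulZl (c : k) (x y : kQ) :
  c *: pathalg_mul x y = pathalg_mul (c *: x) y.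
Proof.
rewrite (pathalg_mulw (msuppZ_le _ _) (fsubset_refl _)) pathalg_mul.unlock scaler_sumr.
apply: eq_bigr => p _; rewrite scaler_sumr; apply: eq_bigr => q _.
by rewrite mcoeffZ scalerA mulrA.
Qed.

Lemma pathalg_mulZr (c : k) (x y : kQ) :
  c *: pathalg_mul x y = pathalg_mul x (c *: y).
Proof.
rewrite (pathalg_mulw (fsubset_refl _) (msuppZ_le _ _)) pathalg_mul.unlock scaler_sumr.
apply: eq_bigr => p _; rewrite scaler_sumr; apply: eq_bigr => q _.
by rewrite mcoeffZ scalerA mulrCA.
Qed.

Lemma pathalg_mul0l y : pathalg_mul 0 y = 0.
Proof. by rewrite pathalg_mul.unlock msupp0 big_seq_fset0. Qed.

Lemma pathalg_mul0r x : pathalg_mul x 0 = 0.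
Proof. by rewrite pathalg_mul.unlock big1 // => p _; rewrite msupp0 big_seq_fset0. Qed.

Lemma pathalg_mul_suml (I : Type) (r : seq I) (F : I -> kQ) y :
  pathalg_mul (\sum_(i <- r) F i) y = \sum_(i <- r) pathalg_mul (F i) y.
Proof.
exact: (big_morph (pathalg_mul^~ y) (fun a b => pathalg_mulDl a b y)
  (pathalg_mul0l y)).
Qed.

Lemma pathalg_mul_sumr (I : Type) (r : seq I) (F : I -> kQ) x :
  pathalg_mul x (\sum_(i <- r) F i) = \sum_(i <- r) pathalg_mul x (F i).
Proof.
exact: (big_morph (pathalg_mul x) (pathalg_mulDr x) (pathalg_mul0r x)).
Qed.

Lemma pathalg_mul_opathr p o :
  pathalg_mul (path_elt p) (opath_elt o) = opath_elt (obind (pcomp p) o).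
Proof. by case: o => [q|]; [exact: pathalg_mul_path|exact: pathalg_mul0r]. Qed.

Lemma pathalg_mul_opathl p o :
  pathalg_mul (opath_elt o) (path_elt p) = opath_elt (obind (fun u => pcomp u p) o).
Proof. by case: o => [q|]; [exact: pathalg_mul_path|exact: pathalg_mul0l]. Qed.

Lemma pathalg_mulA_path p q r :
  pathalg_mul (path_elt p) (pathalg_mul (path_elt q) (path_elt r)) =
  pathalg_mul (pathalg_mul (path_elt p) (path_elt q)) (path_elt r).
Proof.
rewrite (pathalg_mul_path q r) (pathalg_mul_path p q).
by rewrite pathalg_mul_opathr pathalg_mul_opathl pcompA.
Qed.

Lemma pathalg_mulA_path2 p q z :
  pathalg_mul (path_elt p) (pathalg_mul (path_elt q) z) =
  pathalg_mul (pathalg_mul (path_elt p) (path_elt q)) z.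
Proof.
rewrite [z]pathalgE !pathalg_mul_sumr; apply: eq_bigr => r _.
by rewrite -3!pathalg_mulZr pathalg_mulA_path.
Qed.

Lemma pathalg_mulA_path1 p y z :
  pathalg_mul (path_elt p) (pathalg_mul y z) =
  pathalg_mul (pathalg_mul (path_elt p) y) z.
Proof.
rewrite [y]pathalgE pathalg_mul_suml !pathalg_mul_sumr pathalg_mul_suml.
apply: eq_bigr => q _.
rewrite -(pathalg_mulZl _ (path_elt q) z).
rewrite -[in RHS](pathalg_mulZr _ (path_elt p) (path_elt q)).
rewrite -(pathalg_mulZr _ (path_elt p) (pathalg_mul (path_elt q) z)).
rewrite -(pathalg_mulZl _ (pathalg_mul (path_elt p) (path_elt q)) z).
by rewrite pathalg_mulA_path2.
Qed.

Lemma pathalg_mulA : associative pathalg_mul.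
Proof.
move=> x y z; rewrite [x]pathalgE !pathalg_mul_suml; apply: eq_bigr => p _.
by rewrite -3!pathalg_mulZl pathalg_mulA_path1.
Qed.

Lemma pathalg_mul1 : left_id pathalg_one pathalg_mul.
Proof.
move=> x; rewrite [RHS]pathalgE [X in pathalg_mul _ X]pathalgE pathalg_mul_sumr.
apply: eq_bigr => p _; rewrite -pathalg_mulZr; congr (_ *: _).
rewrite pathalg_mul_suml (bigD1 (pstart p)) //= pathalg_mul_path pcomp1p eqxx.
rewrite big1 ?addr0 // => i ne; rewrite pathalg_mul_path pcomp1p.
by rewrite (negPf ne).
Qed.

Lemma pathalg_1mul : right_id pathalg_one pathalg_mul.
Proof.
move=> x; rewrite [RHS]pathalgE [X in pathalg_mul X _]pathalgE pathalg_mul_suml.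
apply: eq_bigr => p _; rewrite -pathalg_mulZl; congr (_ *: _).
rewrite pathalg_mul_sumr (bigD1 (pend p)) //= pathalg_mul_path pcompp1 eqxx.
rewrite big1 ?addr0 // => i ne; rewrite pathalg_mul_path pcompp1 eq_sym.
by rewrite (negPf ne).
Qed.

HB.instance Definition _ := GRing.Zmodule_isPzRing.Build kQ
  pathalg_mulA pathalg_mul1 pathalg_1mul pathalg_mulDl pathalg_mulDr.

Lemma pathalg_scalerAl (c : k) (x y : kQ) : c *: (x * y) = (c *: x) * y.
Proof. exact: pathalg_mulZl. Qed.

Lemma pathalg_scalerAr (c : k) (x y : kQ) : c *: (x * y) = x * (c *: y).
Proof. exact: pathalg_mulZr. Qed.

Definition arrow_ideal : ideal kQ :=
  gen_ideal [set path_elt (arrow_path a) | a in [set: arrow Q]].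

Definition admissible (I : ideal kQ) : Prop :=
  exists2 m, (2 <= m)%N &
    set_exp arrow_ideal m `<=` I /\ I `<=` set_exp arrow_ideal 2.

Definition path_part (P : pred (qpath Q)) (x : kQ) : kQ :=
  \sum_(p <- msupp x | P p) x@_p *: path_elt p.

Definition occurs (p : qpath Q) (x : kQ) : Prop := x@_p != 0.
End PathAlgebra.

Local Open Scope quotient_scope.

(* MathComp's lalgType and algType (hence {lrmorphism _ -> _}) require 1 != 0,
   whereas a quotient of kQ by an arbitrary ideal may be zero.  Path algebras
   and their quotients are therefore equipped with a pzRingType and an
   lmodType k structure, related by the lemmas *_scalerAl and *_scalerAr. *)
Section QuiverAlgebra.
Variables (k : fieldType) (Q : quiver) (I : ideal (path_algebra k Q)).
Local Notation A := (path_algebra k Q).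

Definition quiver_algebra : Type := Quotient.quot (ideal_mem I).
Local Notation B := quiver_algebra.

HB.instance Definition _ := GRing.Zmodule.on B.
HB.instance Definition _ : EqQuotient A (Quotient.equiv (ideal_mem I)) B :=
  EqQuotient.on B.

Definition quot_proj (x : A) : B := \pi_B x.

Lemma quot_projP (x y : A) : quot_proj x = quot_proj y <-> ideal_set I (x - y).
Proof.
split=> [/eqP|Ixy]; first by rewrite -Quotient.idealrBE => /ideal_memP.
by apply/eqP; rewrite -Quotient.idealrBE; apply/ideal_memP.
Qed.

Lemma quot_proj_surj (b : B) : exists x, quot_proj x = b.
Proof. by exists (repr b); rewrite /quot_proj reprK. Qed.

Lemma quot_projB : zmod_morphism quot_proj.
Proof.
move=> x y; rewrite /quot_proj.
exact: (@pi_is_zmod_morphism _ _ _ (Quotient.quot (ideal_mem I))).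
Qed.

HB.instance Definition _ :=
  GRing.isZmodMorphism.Build A B quot_proj quot_projB.

Definition quot_mul (b c : B) : B := quot_proj (repr b * repr c).
Definition quot_scale (a : k) (b : B) : B := quot_proj (a *: repr b).

Lemma quot_reprP x : x - repr (quot_proj x) \in ideal_mem I.
Proof. by apply/ideal_memP/quot_projP; rewrite /quot_proj reprK. Qed.

Lemma quot_mulE x y : quot_mul (quot_proj x) (quot_proj y) = quot_proj (x * y).
Proof.
apply/esym/quot_projP/ideal_memP.
set x' := repr _; set y' := repr _.
have -> : x * y - x' * y' = (x - x') * y + x' * (y - y').
  by rewrite mulrBl mulrBr addrA subrK.
apply: rpredD; first by apply: ideal_mem_mulr; apply: quot_reprP.
by apply: ideal_mem_mull; apply: quot_reprP.
Qed.

Lemma quot_scaleE a x : quot_scale a (quot_proj x) = quot_proj (a *: x).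
Proof.
apply/esym/quot_projP/ideal_memP; rewrite -scalerBr -[X in a *: X]mul1r.
by rewrite pathalg_scalerAl; apply: ideal_mem_mull; apply: quot_reprP.
Qed.

Lemma quot_mulA : associative quot_mul.
Proof.
move=> b c d; have [x <-] := quot_proj_surj b; have [y <-] := quot_proj_surj c.
by have [z <-] := quot_proj_surj d; rewrite !quot_mulE mulrA.
Qed.

Lemma quot_mul1 : left_id (quot_proj 1) quot_mul.
Proof. by move=> b; have [x <-] := quot_proj_surj b; rewrite quot_mulE mul1r. Qed.

Lemma quot_1mul : right_id (quot_proj 1) quot_mul.
Proof. by move=> b; have [x <-] := quot_proj_surj b; rewrite quot_mulE mulr1. Qed.

Lemma quot_mulDl : left_distributive quot_mul +%R.
Proof.
move=> b c d; have [x <-] := quot_proj_surj b; have [y <-] := quot_proj_surj c.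
have [z <-] := quot_proj_surj d.
by rewrite -raddfD !quot_mulE mulrDl raddfD.
Qed.

Lemma quot_mulDr : right_distributive quot_mul +%R.
Proof.
move=> b c d; have [x <-] := quot_proj_surj b; have [y <-] := quot_proj_surj c.
have [z <-] := quot_proj_surj d.
by rewrite -raddfD !quot_mulE mulrDr raddfD.
Qed.

HB.instance Definition _ := GRing.Zmodule_isPzRing.Build B
  quot_mulA quot_mul1 quot_1mul quot_mulDl quot_mulDr.

Lemma quot_scaleA a b v : quot_scale a (quot_scale b v) = quot_scale (a * b) v.
Proof. by have [x <-] := quot_proj_surj v; rewrite !quot_scaleE scalerA. Qed.

Lemma quot_scale1 : left_id 1 quot_scale.
Proof. by move=> v; have [x <-] := quot_proj_surj v; rewrite quot_scaleE scale1r. Qed.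

Lemma quot_scaleDr : right_distributive quot_scale +%R.
Proof.
move=> a b c; have [x <-] := quot_proj_surj b; have [y <-] := quot_proj_surj c.
by rewrite -raddfD !quot_scaleE scalerDr raddfD.
Qed.

Lemma quot_scaleDl v : {morph quot_scale^~ v : a b / a + b}.
Proof.
by move=> a b; have [x <-] := quot_proj_surj v; rewrite !quot_scaleE scalerDl raddfD.
Qed.

HB.instance Definition _ := GRing.Zmodule_isLmodule.Build k B
  quot_scaleA quot_scale1 quot_scaleDr quot_scaleDl.

Lemma quot_scalerAl (c : k) (x y : B) : c *: (x * y) = (c *: x) * y.
Proof.
have [u <-] := quot_proj_surj x; have [v <-] := quot_proj_surj y.
rewrite /GRing.mul /= /GRing.scale /= !(quot_mulE, quot_scaleE).
by rewrite pathalg_scalerAl.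
Qed.

Lemma quot_scalerAr (c : k) (x y : B) : c *: (x * y) = x * (c *: y).
Proof.
have [u <-] := quot_proj_surj x; have [v <-] := quot_proj_surj y.
rewrite /GRing.mul /= /GRing.scale /= !(quot_mulE, quot_scaleE).
by rewrite pathalg_scalerAr.
Qed.

Lemma quot_proj_monoid_morphism : monoid_morphism quot_proj.
Proof. by split=> // x y; rewrite -quot_mulE. Qed.

HB.instance Definition _ :=
  GRing.isMonoidMorphism.Build A B quot_proj quot_proj_monoid_morphism.

Lemma quot_proj_scalable : scalable quot_proj.
Proof. by move=> a x; rewrite -quot_scaleE. Qed.

HB.instance Definition _ :=
  GRing.isScalable.Build k A B *:%R quot_proj quot_proj_scalable.
End QuiverAlgebra.

Local Close Scope quotient_scope.

(* Since p * q is "p followed by q", the left ideal generated by e_i is spanned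
   by the classes of the paths ending at i. *)
Definition vertex_module (k : fieldType) (Q : quiver)
    (I : ideal (path_algebra k Q)) (i : vertex Q) : set (quiver_algebra I)^o :=
  [set x * quot_proj I (path_elt k (trivial_path i)) |
     x in [set: quiver_algebra I]].

Arguments vertex_module [k Q] I i _.

Definition short_vertex (k : fieldType) (Q : quiver)
    (I : ideal (path_algebra k Q)) (l : nat) : pred (vertex Q) :=
  fun i => ~~ `[< is_loewy_length (vertex_module I i) l >].

Section AddLoops.
Variables (Q : quiver) (S : pred (vertex Q)).

Definition add_loops : quiver :=
  @Quiver (vertex Q) (arrow Q + {i : vertex Q | S i})%type
    (fun a => match a with inl b => source b | inr i => val i end)
    (fun a => match a with inl b => target b | inr i => val i end).

Definition old_arrow (a : arrow Q) : arrow add_loops := inl a.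
Definition new_loop (i : {i : vertex Q | S i}) : arrow add_loops := inr i.

Lemma old_path_walk (p : qpath Q) :
  is_walk (Q := add_loops) (pstart p) (map old_arrow (parrows p)).
Proof.
case: p => -[v s]; rewrite /pstart /parrows /=.
by elim: s v => //= a s IH v /andP[-> /IH].
Qed.

Definition old_path (p : qpath Q) : qpath add_loops :=
  @QPath add_loops (pstart p, map old_arrow (parrows p)) (old_path_walk p).

Definition path_incl (k : fieldType) (x : path_algebra k Q) :
    path_algebra k add_loops :=
  \sum_(p <- msupp x) x@_p *: path_elt k (old_path p).

Definition has_loop (p : qpath add_loops) : bool :=
  `[< exists i, divides (arrow_path (new_loop i)) p >].

Definition part_B (k : fieldType) (w : path_algebra k add_loops) :
    path_algebra k add_loops := path_part has_loop w.

Definition part_notB (k : fieldType) (w : path_algebra k add_loops) :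
    path_algebra k add_loops := path_part (predC has_loop) w.

(* The equations with [pcomp] include the requirement that the two arrows be
   composable, i.e. that c ends (resp. d starts) at the vertex of the loop. *)
Definition Tu (l : nat) : set (qpath add_loops) :=
  [set p : qpath add_loops | exists i : {i : vertex Q | S i},
     [\/ pstart p = val i /\ parrows p = nseq l (new_loop i),
         exists c, pcomp (arrow_path (old_arrow c))
                         (arrow_path (new_loop i)) = Some p |
         exists d, pcomp (arrow_path (new_loop i))
                         (arrow_path (old_arrow d)) = Some p]].
End AddLoops.

Section Uniformization.
Variables (k : fieldType) (Q : quiver) (I : ideal (path_algebra k Q)) (l : nat).

Definition unif_quiver : quiver := add_loops (short_vertex I l).

Definition unif_ideal : ideal (path_algebra k unif_quiver) :=
  gen_ideal ([set path_incl (short_vertex I l) x | x in I] `|`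
             [set path_elt k p | p in Tu (S := short_vertex I l) l]).
End Uniformization.

(* Main.v *)
Require Import Defs.
From HB Require Import structures.
From mathcomp Require Import all_boot all_order all_algebra.
From mathcomp Require Import finmap monalg.
From mathcomp Require Import boolp classical_sets.

(** Why the theorem holds. Every statement reduces to bookkeeping on paths, once
    [I^*] is known explicitly.

    The inclusion of [Q] in [Q^*] and the map killing the loops induce
    homomorphisms [inclusion] and [restriction] of path algebras, with
    [restriction] a left inverse of [inclusion]. An element [w] belongs to [I^*]
    exactly when [restriction w] is in [I] and every path through a loop that
    occurs in [w] is divided by a path of [T_u] ([Istar_star_set]). The only point
    is that the right-hand side is an ideal. When a path occurring in an element
    of [I] is multiplied by a path through a loop, the product contains a loop
    and, [I] being admissible, an arrow of [Q]; somewhere along it a loop and an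
    arrow of [Q] are adjacent, and that pair is in [T_u]. This gives (i), and shows
    that the two homomorphisms descend to the quotients, which gives (iii).

    For (ii), let [long t] be the span of the paths of length at least [t]. In any
    quotient [kQ/I] with [long m] contained in [I] and [I] contained in [long 1],
    the [t]-th power of the Jacobson radical is the image of [long t]
    ([jacobson_exp]). This applies to [I], and also to [I^*] with [m = l]: a path of
    length at least [l] in [Q^*] mixes loops and arrows, or is a power of one loop, or a
    path of [Q] that lies in [I]. So the Loewy length of [kQ^*/I^*] is at most [l].
    Conversely, at each vertex [i] some combination [y] of paths of length at least
    [l - 1] ending at [i] is not in [I^*]: a power of the new loop if [i] is short,
    and the image of an element of [kQ] otherwise ([long_ending_at]). A nonzero
    direct summand contains a nonzero idempotent [e], which has a nonzero
    coefficient at some [e_i], and the corresponding [y] satisfies [y * e <> 0]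
    ([summand_loewy]). Thus every nonzero summand has Loewy length [l]. *)

Set Implicit Arguments.
Unset Strict Implicit.
Unset Printing Implicit Defensive.

Import GRing.Theory.

Local Open Scope classical_set_scope.
Local Open Scope ring_scope.

(* The composition of partial functions bears the same name. *)
Local Notation pcomp := Defs.pcomp.

(** * Coefficients and supports in a path algebra *)

Section Coefficients.
Variables (k : fieldType) (Q : quiver).
Local Notation kQ := (path_algebra k Q).
Implicit Types (x y : kQ) (p q r : qpath Q).

Lemma coeff_path_elt p q : (path_elt k p)@_q = (p == q)%:R.
Proof. by rewrite path_elt.unlock [LHS]mcoeffU. Qed.

Lemma occurs_supp p x : occurs p x <-> p \in msupp x.
Proof. by rewrite -mcoeff_neq0. Qed.

Lemma occurs_path_elt p q : occurs p (path_elt k q) <-> p = q.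
Proof.
rewrite /occurs coeff_path_elt.
case: (eqVneq q p) => [->|ne]; first by rewrite oner_eq0.
by rewrite eqxx; split=> // e; rewrite e eqxx in ne.
Qed.

Lemma occursD p x y : occurs p (x + y) -> occurs p x \/ occurs p y.
Proof.
rewrite /occurs mcoeffD; case: (eqVneq (x@_p) 0) => [->|nx _]; last by left.
by rewrite add0r; right.
Qed.

Lemma occursZ c p x : occurs p (c *: x) -> occurs p x.
Proof.
rewrite /occurs (mcoeffZ c).
by apply: contra_neq => ->; rewrite mulr0.
Qed.

Lemma occurs_sum (T : eqType) (s : seq T) (P : pred T) (F : T -> kQ) p :
  occurs p (\sum_(i <- s | P i) F i) -> exists i, [/\ i \in s, P i & occurs p (F i)].
Proof.
elim: s => [|i s IH]; first by rewrite big_nil /occurs mcoeff0 eqxx.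
have tl : occurs p (\sum_(j <- s | P j) F j) ->
    exists j, [/\ j \in i :: s, P j & occurs p (F j)].
  by move=> /IH[j [js Pj o]]; exists j; rewrite in_cons js orbT.
rewrite big_cons; case Pi: (P i) => // o.
by case: (occursD o) => // {}o; exists i; rewrite mem_head.
Qed.

Lemma occursM r x y : occurs r (x * y) ->
  exists p q, [/\ occurs p x, occurs q y & pcomp p q = Some r].
Proof.
have -> : x * y = pathalg_mul x y by [].
rewrite pathalg_mul.unlock => /occurs_sum[p [px _ /occurs_sum[q [qy _ /occursZ]]]].
case E: (pcomp p q) => [u|]; last by rewrite /occurs mcoeff0 eqxx.
move=> /occurs_path_elt ->.
by exists p, q; split=> //; apply/occurs_supp.
Qed.

Lemma path_eltM p q : path_elt k p * path_elt k q = opath_elt k (pcomp p q).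
Proof. exact: pathalg_mul_path. Qed.

Lemma pathalg_scaleE c x : c *: x = (c *: (1 : kQ)) * x.
Proof. by rewrite -pathalg_scalerAl mul1r. Qed.

(** Ideals are only assumed stable under multiplication; scalars act through
    multiples of [1]. *)
Lemma idealZ (I : ideal kQ) c x : ideal_set I x -> ideal_set I (c *: x).
Proof.
move=> Ix; rewrite pathalg_scaleE.
by case: (ideal_setP I) => _ _ /(_ (c *: (1 : kQ)) 1 x Ix); rewrite mulr1.
Qed.

Lemma ideal_sum (I : ideal kQ) (T : eqType) (s : seq T) (F : T -> kQ) :
  (forall i, i \in s -> ideal_set I (F i)) -> ideal_set I (\sum_(i <- s) F i).
Proof.
case: (ideal_setP I) => I0 ID _ H; rewrite big_seq.
by apply: big_ind.
Qed.

Lemma ideal_of_occurs (I : ideal kQ) x :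
  (forall p, occurs p x -> ideal_set I (path_elt k p)) -> ideal_set I x.
Proof.
move=> H; rewrite [x]pathalgE; apply: ideal_sum => p /occurs_supp /H.
exact: idealZ.
Qed.
End Coefficients.

(** * The filtration by path length *)

Section Length.
Variables (k : fieldType) (Q : quiver).
Local Notation kQ := (path_algebra k Q).

Definition plen (p : qpath Q) : nat := size (parrows p).

Lemma plen_pcomp (p q r : qpath Q) : pcomp p q = Some r -> plen r = (plen p + plen q)%N.
Proof. by case/pcompP => _ _ e; rewrite /plen e size_cat. Qed.

Lemma plen_eq0 (p : qpath Q) : plen p = 0%N -> p = trivial_path (pstart p).
Proof. by move/eqP; rewrite size_eq0 => /eqP e; apply: qpathP. Qed.

Definition long (t : nat) : set kQ := [set x | forall p, occurs p x -> (t <= plen p)%N].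

Lemma long0 : long 0 = setT.
Proof. by apply/seteqP; split=> // x _ p. Qed.

Lemma long_le s t x : (s <= t)%N -> long t x -> long s x.
Proof. by move=> st L p /L; apply: leq_trans. Qed.

Lemma long_zero t : long t 0.
Proof. by move=> p; rewrite /occurs mcoeff0 eqxx. Qed.

Lemma longD t x y : long t x -> long t y -> long t (x + y).
Proof. by move=> Lx Ly p /occursD[/Lx|/Ly]. Qed.

Lemma longM s t x y : long s x -> long t y -> long (s + t) (x * y).
Proof.
move=> Lx Ly r /occursM[p [q [/Lx sp /Ly tq /plen_pcomp ->]]].
exact: leq_add.
Qed.

Lemma long_elt t p : (t <= plen p)%N -> long t (path_elt k p).
Proof. by move=> tp q /occurs_path_elt ->. Qed.

Lemma long1_coeff x :
  long 1 x <-> forall i : vertex Q, x@_(trivial_path i) = 0.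
Proof.
split=> [L i|H p].
  by apply/eqP; apply: contrapT => /negP /L.
rewrite /occurs lt0n; apply: contra_neqN => /eqP /plen_eq0 ->; exact: H.
Qed.

Lemma is_ideal_long t : is_ideal (long t).
Proof.
split; [exact: long_zero|exact: longD|move=> a b x Lx].
have L0 y : long 0 y by rewrite long0.
by have := longM (longM (L0 a) Lx) (L0 b); rewrite addn0.
Qed.

Lemma path_split_arrow p t : (t < plen p)%N ->
  exists a q, path_elt k p = path_elt k (arrow_path a) * path_elt k q /\
              (t <= plen q)%N.
Proof.
case: p => -[v [|a s]] // w; rewrite /plen /parrows /= ltnS => ts.
have /andP[/eqP e ws] := w.
exists a, (@QPath Q (target a, s) ws); split=> //.
rewrite path_eltM; have /pcompP-> // : [/\ pend (arrow_path a) =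
  pstart (@QPath Q (target a, s) ws), pstart (QPath w) = pstart (arrow_path a) &
  parrows (QPath w) = parrows (arrow_path a) ++ s] by split.
Qed.

(** This computes the powers of the arrow ideal of [kQ] (for the identity) and
    of the radical of a quotient (for the projection) at one stroke: a path of
    length [t.+1] is an arrow followed by a path of length [t]. *)
Lemma set_exp_long (A : pzRingType) (f : {rmorphism kQ -> A}) t :
  (forall y, exists x, f x = y) ->
  set_exp (f @` long 1) t = f @` long t.
Proof.
move=> surj; elim: t => [|t IH].
  rewrite long0 /=; apply/seteqP; split=> // y _.
  by have [x <-] := surj y; exists x.
rewrite /set_exp iterS -/(set_exp _ _) IH; apply/seteqP; split=> y /=.
  case=> s [H ->]; elim: s H => [|u s IHs] H.
    by exists 0; [exact: long_zero|rewrite raddf0 big_nil].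
  have [z Lz ez] := IHs (fun v vs => H v (mem_behead (s := u :: s) vs)).
  have [[a La ea] [b Lb eb]] := H u (mem_head _ _).
  exists (a * b + z); last by rewrite big_cons rmorphD rmorphM ea eb ez.
  by apply: longD => //; rewrite -add1n; apply: longM.
case=> x Lx <-.
suff H p : occurs p x -> exists u : A * A,
    [/\ (f @` long 1) u.1, (f @` long t) u.2 & f (x@_p *: path_elt k p) = u.1 * u.2].
  have [g Hg] : {g : qpath Q -> A * A & forall p, occurs p x ->
    [/\ (f @` long 1) (g p).1, (f @` long t) (g p).2 &
        f (x@_p *: path_elt k p) = (g p).1 * (g p).2]}.
    apply: (@choice _ _ (fun p u => occurs p x -> [/\ (f @` long 1) u.1,
      (f @` long t) u.2 & f (x@_p *: path_elt k p) = u.1 * u.2])) => p.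
    have [/H[u Hu]|no] := pselect (occurs p x); first by exists u.
    by exists (0, 0).
  exists (map g (msupp x)); split.
    by move=> u /mapP[p /occurs_supp /Hg[? ? _] ->].
  rewrite {1}[x]pathalgE rmorph_sum big_map; apply: eq_big_seq => p /occurs_supp.
  by case/Hg.
move=> o; have [a [q [-> tq]]] := path_split_arrow (Lx _ o).
exists (f (x@_p *: path_elt k (arrow_path a)), f (path_elt k q)); split=> /=.
- by exists (x@_p *: path_elt k (arrow_path a)) => // r /occursZ /occurs_path_elt ->.
- by exists (path_elt k q) => //; apply: long_elt.
- by rewrite pathalg_scalerAl rmorphM.
Qed.

Lemma arrow_ideal_long : arrow_ideal k Q = long 1 :> set kQ.
Proof.
apply/seteqP; split=> x.
  move/(_ (Ideal (is_ideal_long 1))); apply=> _ [a _ <-].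
  exact: long_elt.
move=> Lx; apply: ideal_of_occurs => p /Lx /path_split_arrow[a [q [-> _]]].
rewrite -[path_elt k (arrow_path a)]mul1r.
case: (ideal_setP (arrow_ideal k Q)) => _ _; apply=> J; apply.
by exists a.
Qed.

Lemma arrow_ideal_exp t : set_exp (arrow_ideal k Q) t = long t.
Proof.
have := @set_exp_long _ idfun t (fun y => ex_intro _ y erefl).
by rewrite !image_id arrow_ideal_long.
Qed.
End Length.

Arguments long {k Q} t _.

(** * Radical and Loewy length of a quotient of a path algebra *)

(** The idempotent is the component in [N] of [1] along the decomposition. *)
Lemma summand_idempotent (R : pzRingType) (N : set R^o) :
  is_direct_summand N -> N <> [set 0] ->
  exists e : R, [/\ N e, e * e = e & e <> 0].
Proof.
case=> N' [[N0 NL] [N'0 N'L] cap sum] N_neq0.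
have [e Ne [e' Ne' ee']] : [set x + y | x in N & y in N'] (1 : R^o) by rewrite -sum.
have scal (a x : R^o) : N x -> N (a * x).
  by move=> Nx; have := NL a x 0 Nx N0; rewrite addr0.
have scal' (a x : R^o) : N' x -> N' (a * x).
  by move=> Nx; have := N'L a x 0 Nx N'0; rewrite addr0.
exists e; split=> //.
  have Ee : e * e' = e - e * e by rewrite -{2}[e]mulr1 -ee' mulrDr addrAC subrr add0r.
  apply/esym/subr0_eq; rewrite -Ee.
  suff : (N `&` N') (e * e') by rewrite cap.
  split; last exact: scal'.
  rewrite Ee addrC -mulN1r -[X in _ + X]mulr1.
  by have := NL (-1) _ _ (scal e _ Ne) Ne; rewrite mulr1.
move=> e0; apply: N_neq0; apply/seteqP; split=> x; last by move=> ->.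
move=> Nx; have : (N `&` N') x; last by rewrite cap.
split=> //; rewrite -[x]mulr1 -ee' e0 add0r; exact: scal'.
Qed.

Section Radical.
Variables (k : fieldType) (Q : quiver) (I : ideal (path_algebra k Q)).
Local Notation kQ := (path_algebra k Q).
Local Notation qp := (quot_proj I).

Lemma quot_proj_eq0 x : qp x = 0 <-> ideal_set I x.
Proof. by rewrite -(rmorph0 qp); have := quot_projP I x 0; rewrite subr0. Qed.

Hypothesis I_long1 : ideal_set I `<=` long 1.

(** The coefficient of [e_i] is a character of [kQ] that vanishes on [I]; its
    kernel in the quotient is a maximal left ideal. *)
Definition vertex_kernel (i : vertex Q) : set (quiver_algebra I)^o :=
  qp @` [set x : kQ | x@_(trivial_path i) = 0].

Lemma vertex_kernelP i x : vertex_kernel i (qp x) <-> x@_(trivial_path i) = 0.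
Proof.
split=> [[y y0 /esym/quot_projP/I_long1/long1_coeff/(_ i)]|]; last by exists x.
by rewrite mcoeffB y0 subr0.
Qed.

Lemma coeff_vertexM i (a x : kQ) :
  x@_(trivial_path i) = 0 -> (a * x)@_(trivial_path i) = 0.
Proof.
move=> x0; apply/eqP; apply: contrapT => /negP /occursM[p [q [_ qx pq]]].
suff qi : q = trivial_path i by move: qx; rewrite /occurs qi x0 eqxx.
have /eqP : plen (trivial_path i) = 0%N by [].
rewrite (plen_pcomp pq) addn_eq0 => /andP[_ /eqP /plen_eq0 qe].
by have := pcomp_end pq; rewrite qe => e; congr trivial_path; rewrite [RHS]e.
Qed.

Lemma coeff_vertex1 i : (1 : kQ)@_(trivial_path i) = 1.
Proof.
have -> : (1 : kQ) = \sum_(j : vertex Q) path_elt k (trivial_path j) by [].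
rewrite raddf_sum (bigD1 i) //= coeff_path_elt eqxx big1 ?addr0 // => j ne.
rewrite coeff_path_elt; case: (eqVneq (trivial_path j)) => //.
by move=> /(congr1 (@pstart Q)) e; rewrite -[j]/(pstart (trivial_path j)) e eqxx in ne.
Qed.

Lemma vertex_kernel_maximal i : is_maximal_submodule (vertex_kernel i).
Proof.
split.
- split=> [|a _ _ [x x0 <-] [y y0 <-]].
    by exists 0; rewrite /= ?mcoeff0 ?rmorph0.
  have [u <-] := quot_proj_surj a; exists (u * x + y); last by rewrite rmorphD rmorphM.
  by rewrite /= mcoeffD (coeff_vertexM _ x0) y0 addr0.
- move=> e; have : vertex_kernel i (qp 1) by rewrite e.
  by move/vertex_kernelP/eqP; rewrite coeff_vertex1 oner_eq0.
- move=> N [N0 NL] sub.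
  have [all|/existsNP[b nb]] := pselect (forall b, N b -> vertex_kernel i b).
    by left; apply/seteqP; split.
  right; apply/seteqP; split=> // y _; move/not_implyP: nb => [Nb].
  have [x xb] := quot_proj_surj b; rewrite -xb => nK.
  have {nK} c0 : x@_(trivial_path i) != 0.
    by apply: contra_notN nK => /eqP /vertex_kernelP.
  set c := x@_(trivial_path i) in c0.
  have K1 : vertex_kernel i (qp (1 - c^-1 *: x)).
    apply/vertex_kernelP.
    by rewrite mcoeffB (mcoeffZ c^-1) coeff_vertex1 mulVf ?subrr.
  have N1 : N 1.
    have := NL (qp (c^-1 *: (1 : kQ))) _ _ Nb (sub _ K1).
    suff -> : qp (c^-1 *: (1 : kQ)) *: (b : (quiver_algebra I)^o) +
      qp (1 - c^-1 *: x) = 1 by [].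
    rewrite -xb -[_ *: _]rmorphM -rmorphD -pathalg_scaleE addrC subrK.
    exact: rmorph1.
  by have := NL y 1 0 N1 N0; rewrite addr0 -[X in N X -> _]/(y * 1) mulr1.
Qed.

Lemma jacobson_sub_long : jacobson (R := quiver_algebra I) `<=` qp @` long 1.
Proof.
move=> b; have [x <-] := quot_proj_surj b => J; exists x => //.
by apply/long1_coeff => i; apply/vertex_kernelP; apply: J; apply: vertex_kernel_maximal.
Qed.

Variable m : nat.
Hypothesis I_longm : long m `<=` ideal_set I.

(** If [x] lay outside a maximal left ideal [L], then [1 = y + a * x] with [y]
    in [L]; but [z = a * x] is nilpotent, so that [1 - z], which is in [L],
    is left invertible. *)
Lemma long_sub_jacobson : qp @` long 1 `<=` jacobson (R := quiver_algebra I).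
Proof.
move=> _ [x Lx <-] L [[L0 LL] LT Lmax]; apply: contrapT => nLx.
pose N : set (quiver_algebra I)^o := [set y | exists2 a, L (y - a * qp x) & True].
have subN : is_submodule N.
  split=> [|a y z [b Lb _] [c Lc _]]; first by exists 0; rewrite // mul0r subr0.
  exists (a * b + c) => //.
  suff -> : a *: y + z - (a * b + c) * qp x =
    a *: (y - b * qp x) + (z - c * qp x) by exact: LL.
  rewrite [a *: (_ - _)]mulrBr mulrDl opprD mulrA addrACA.
  by [].
have LN : L `<=` N by move=> y Ly; exists 0; rewrite // mul0r subr0.
case: (Lmax N subN LN) => [NL|NT].
  by apply: nLx; rewrite -NL; exists 1; rewrite // mul1r subrr.
have [a L1 _] : N 1 by rewrite NT.
have [u au] := quot_proj_surj a.
set z := a * qp x in L1.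
have Lz n : L (1 - z ^+ n).
  elim: n => [|n IH]; first by rewrite expr0 subrr.
  have := LL z _ _ IH L1; rewrite [z *: _]mulrBr mulr1 -exprS.
  by rewrite addrC addrA subrK.
have zm : z ^+ m = 0.
  rewrite /z -au -rmorphM -rmorphXn; apply/quot_proj_eq0/I_longm.
  have Lux : long 1 (u * x).
    by rewrite -[1%N]add0n; apply: longM => //; rewrite long0.
  elim: (m) => [|n IH]; first by rewrite long0.
  by rewrite exprS -add1n; apply: longM.
apply: LT; apply/seteqP; split=> // y _; have := Lz m; rewrite zm subr0 => L1'.
by have := LL y 1 0 L1' L0; rewrite addr0 -[X in L X -> _]/(y * 1) mulr1.
Qed.

Lemma jacobson_exp t :
  set_exp (jacobson (R := quiver_algebra I)) t = qp @` long t.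
Proof.
suff -> : jacobson (R := quiver_algebra I) = qp @` long 1.
  by apply: set_exp_long => y; apply: quot_proj_surj.
by apply/seteqP; split; [exact: jacobson_sub_long|exact: long_sub_jacobson].
Qed.

(** The idempotent [e] of a nonzero summand is not nilpotent, so it has a
    nonzero coefficient [c] at some [e_i]. If [y] is spanned by paths of length
    at least [m - 1] ending at [i], then [y * e = c * y] modulo [I], since the
    other terms of [e] yield paths of length at least [m]; hence one [y] outside
    [I] per vertex suffices to make the Loewy length of every nonzero summand
    equal to [m]. *)
Lemma summand_loewy (N : set (quiver_algebra I)^o) :
  (forall i, exists2 y, long m.-1 y &
     ~ ideal_set I (y * path_elt k (trivial_path i))) ->
  is_direct_summand N -> N <> [set 0] -> is_loewy_length N m.
Proof.
move=> ends sumN N_neq0; split=> [a b|s].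
  rewrite jacobson_exp => -[x Lx <-] _; rewrite (_ : qp x = 0) ?scale0r //.
  by apply/quot_proj_eq0/I_longm.
rewrite jacobson_exp => kN; rewrite leqNgt; apply/negP => sm.
have [e [Ne ee e0]] := summand_idempotent sumN N_neq0.
have [x xe] := quot_proj_surj e.
have [i ci] : exists i, x@_(trivial_path i) <> 0.
  apply/existsNP => x0; apply: e0.
  (* Otherwise [e] would be in the radical, hence nilpotent. *)
  have em n : e ^+ n.+1 = e by elim: n => [|n IH]; rewrite ?expr1 // exprS IH.
  rewrite -(em m) exprS -xe -rmorphXn -rmorphM; apply/quot_proj_eq0/I_longm.
  apply: (@long_le _ _ _ m.+1) => //; rewrite -exprS.
  elim: (m.+1) => [|n IH]; first by rewrite long0.
  by rewrite exprS -add1n; apply: longM => //; apply/long1_coeff.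
set c := x@_(trivial_path i) in ci; set ei := path_elt k (trivial_path i) in ends.
have [y Ly yI] := ends i; apply: yI; rewrite -/ei.
pose r := ei * (x - c *: ei).
have Lr : long 1 r.
  apply/long1_coeff => j; apply/eqP; apply: contrapT => /negP o.
  have [p [q [/occurs_path_elt pE oq pq]]] := occursM o.
  have qi : q = trivial_path i.
    have := plen_pcomp pq; rewrite pE => /esym/eqP.
    rewrite addn_eq0 => /andP[_ /eqP /plen_eq0 qE].
    by case/pcompP: pq; rewrite pE => ei_q _ _; rewrite qE -ei_q.
  move: oq; rewrite /occurs qi mcoeffB (mcoeffZ c) coeff_path_elt eqxx mulr1.
  by rewrite subrr eqxx.
have eiei : ei * ei = ei.
  by rewrite path_eltM pcompp1 eqxx.
have yx : y * ei * x = c *: (y * ei) + y * r.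
  by rewrite /r mulrA mulrBr -!pathalg_scalerAr -[y * ei * ei]mulrA eiei addrC subrK.
have : qp (y * ei * x) = 0.
  rewrite rmorphM /= xe; apply: (kN (qp (y * ei)) e) => //; exists (y * ei) => //.
  apply: (@long_le _ _ _ (m.-1 + 0)); first by rewrite addn0; case: m sm.
  by apply: longM => //; rewrite long0.
rewrite yx => /quot_proj_eq0 Ic.
have Ir : ideal_set I (y * r).
  apply: I_longm; rewrite -[m]prednK; last by case: m sm.
  by rewrite -addn1; apply: longM.
have Icy : ideal_set I (c *: (y * ei)).
  apply/ideal_memP; rewrite -[_ *: _](addrK (y * r)).
  by apply: rpredB; apply/ideal_memP.
have := idealZ c^-1 Icy; rewrite scalerA mulVf ?scale1r //; exact/eqP.
Qed.
End Radical.

(** * Algebra homomorphisms induced by maps on paths *)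

Section PathMap.
Variables (k : fieldType) (Q Q' : quiver) (f : qpath Q -> option (qpath Q')).
Local Notation kQ := (path_algebra k Q).
Local Notation kQ' := (path_algebra k Q').

(** Both the inclusion of a subquiver and the projection killing some arrows
    are linear extensions of partial maps on paths. *)
Definition path_map (x : kQ) : kQ' :=
  \sum_(p <- msupp x) x@_p *: opath_elt k (f p).

Lemma path_mapw (d : {fset qpath Q}) (x : kQ) : (msupp x `<=` d)%fset ->
  path_map x = \sum_(p <- d) x@_p *: opath_elt k (f p).
Proof.
move=> le; apply: big_fset_incl => // p _ /mcoeff_outdom ->.
by rewrite scale0r.
Qed.

Lemma path_map_linear : linear path_map.
Proof.
move=> c x y.
rewrite (path_mapw (d := (msupp x `|` msupp y)%fset)); last first.
  apply: fsubset_trans (msuppD_le _ _) _.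
  by apply: fsetSU; apply: msuppZ_le.
rewrite (path_mapw (fsubsetUl (msupp x) (msupp y))).
rewrite (path_mapw (fsubsetUr (msupp x) (msupp y))).
rewrite scaler_sumr -big_split; apply: eq_bigr => p _ /=.
by rewrite mcoeffD (mcoeffZ c) scalerDl scalerA.
Qed.

HB.instance Definition _ :=
  GRing.isLinear.Build k kQ kQ' *:%R path_map path_map_linear.

Lemma path_map_elt p : path_map (path_elt k p) = opath_elt k (f p).
Proof.
rewrite (path_mapw (d := [fset p]%fset)) ?big_seq_fset1.
  by rewrite coeff_path_elt eqxx scale1r.
by rewrite path_elt.unlock; apply: msuppU_le.
Qed.

Lemma path_mapZ c x : path_map (c *: x) = c *: path_map x.
Proof. exact: linearZ. Qed.

Lemma path_map_sum (s : seq (qpath Q)) (F : qpath Q -> kQ) :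
  path_map (\sum_(p <- s) F p) = \sum_(p <- s) path_map (F p).
Proof. exact: linear_sum. Qed.

Lemma path_map_monoid_morphism :
  path_map 1 = 1 ->
  (forall p q, obind f (pcomp p q) =
               obind (fun u => obind (pcomp u) (f q)) (f p)) ->
  monoid_morphism path_map.
Proof.
move=> f1 fM; split=> //.
have Mpath p q : path_map (path_elt k p * path_elt k q) =
    path_map (path_elt k p) * path_map (path_elt k q).
  rewrite path_eltM !path_map_elt.
  transitivity (opath_elt k (obind f (pcomp p q))).
    by case: (pcomp p q) => [u|]; [exact: path_map_elt|exact: linear0].
  rewrite fM; case: (f p) => [u|]; last by rewrite /= [RHS]mul0r.
  case: (f q) => [v|]; last by rewrite /= [RHS]mulr0.
  by rewrite /= path_eltM.
have Mleft p y : path_map (path_elt k p * y) = path_map (path_elt k p) * path_map y.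
  rewrite {1}[y]pathalgE mulr_sumr path_map_sum [in RHS]/path_map mulr_sumr.
  apply: eq_bigr => q _.
  rewrite -(pathalg_scalerAr y@_q (path_elt k p) (path_elt k q)).
rewrite path_mapZ.
rewrite Mpath.
rewrite -[in RHS]path_map_elt.
exact: pathalg_scalerAr.
move=> x y; rewrite {1}[x]pathalgE mulr_suml path_map_sum [path_map x]/path_map mulr_suml.
apply: eq_bigr => p _.
rewrite -(pathalg_scalerAl x@_p (path_elt k p) y).
rewrite path_mapZ Mleft -[in RHS]path_map_elt.
exact: pathalg_scalerAl.
Qed.
End PathMap.

Lemma quot_lift (k : fieldType) (Q Q' : quiver) (I : ideal (path_algebra k Q))
    (I' : ideal (path_algebra k Q'))
    (F : {linear path_algebra k Q -> path_algebra k Q'}) :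
  monoid_morphism F -> (forall x, ideal_set I x -> ideal_set I' (F x)) ->
  exists g : {rmorphism quiver_algebra I -> quiver_algebra I'},
    scalable g /\ forall x, g (quot_proj I x) = quot_proj I' (F x).
Proof.
move=> [F1 FM] FI.
pose g (b : quiver_algebra I) := quot_proj I' (F (repr b)).
have gE x : g (quot_proj I x) = quot_proj I' (F x).
  apply/quot_projP; rewrite -linearB; apply: FI; apply/quot_projP.
  by rewrite /quot_proj reprK.
have gB : zmod_morphism g.
  move=> b c; have [x <-] := quot_proj_surj b; have [y <-] := quot_proj_surj c.
  by rewrite -rmorphB !gE linearB rmorphB.
have gM : monoid_morphism g.
  split=> [|b c]; first by rewrite -(rmorph1 (quot_proj I)) gE F1 rmorph1.
  have [x <-] := quot_proj_surj b; have [y <-] := quot_proj_surj c.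
  by rewrite -rmorphM !gE FM rmorphM.
pose gZ := GRing.isZmodMorphism.Build _ _ g gB.
pose gMM := GRing.isMonoidMorphism.Build _ _ g gM.
pose G : {rmorphism quiver_algebra I -> quiver_algebra I'} :=
  HB.pack g gZ gMM.
exists G; split=> // c b; have [x <-] := quot_proj_surj b.
by rewrite -linearZ /= !gE !linearZ.
Qed.

(** * Paths in the quiver with loops added *)

Lemma dividesP (Q : quiver) (q p : qpath Q) :
  divides q p <-> exists s1 s2,
    parrows p = s1 ++ parrows q ++ s2 /\ walk_end (pstart p) s1 = pstart q.
Proof.
split=> [[p1 [p2]]|[s1 [s2 [E e]]]].
  case E: (pcomp p1 q) => [u|] //= /pcompP[_ sp ap].
  case/pcompP: E => e su au; exists (parrows p1), (parrows p2).
  by rewrite ap au catA sp su.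
have w : is_walk (pstart p) (s1 ++ parrows q ++ s2) by rewrite -E; apply: qpath_walk.
move: w; rewrite !is_walk_cat e => /and3P[w1 _ w2].
exists (@QPath Q (pstart p, s1) w1), (@QPath Q (walk_end (pstart q) (parrows q), s2) w2).
have [u Eu] := @pcomp_ex _ (@QPath Q (pstart p, s1) w1) q e; rewrite Eu /=.
have [_ su au] := (pcompP _ _ _).1 Eu.
apply/pcompP; split=> //; last by rewrite E au catA.
by rewrite (pcomp_end Eu).
Qed.

Lemma divides_pcomp (Q : quiver) (t p a r : qpath Q) :
  divides t p -> pcomp a p = Some r \/ pcomp p a = Some r -> divides t r.
Proof.
case/dividesP => s1 [s2 [E e]] [] /pcompP[ae sr ar]; apply/dividesP.
  exists (parrows a ++ s1), s2; rewrite ar E -catA; split=> //.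
  by rewrite walk_end_cat sr -[walk_end _ (parrows a)]/(pend a) ae.
by exists s1, (s2 ++ parrows a); rewrite ar E -!catA sr.
Qed.

Lemma has_change (T : Type) (a : pred T) (s : seq T) :
  has a s -> ~~ all a s ->
  exists s1 x y s2, s = s1 ++ x :: y :: s2 /\ a x != a y.
Proof.
elim: s => //= x [|y s] IH; first by rewrite orbF andbT => ->.
have [axy _ _|] := boolP (a x != a y); first by exists [::], x, y, s.
rewrite negbK => /eqP axy h na.
have [||s1 [x' [y' [s2 [-> e]]]]] := IH.
- by move: h => /=; rewrite axy orbA orbb.
- by move: na => /=; rewrite axy andbA andbb.
by exists (x :: s1), x', y', s2.
Qed.

Section Loops.
Variables (Q : quiver) (S : pred (vertex Q)) (l : nat).
Local Notation QS := (add_loops S).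
Implicit Types (p r : qpath QS) (q : qpath Q).

Definition is_loop (a : arrow QS) : bool := if a is inr _ then true else false.

Lemma has_loopE p : has_loop p = has is_loop (parrows p).
Proof.
apply/asboolP/idP => [[i /dividesP[s1 [s2 [-> _]]]]|].
  by rewrite !has_cat /= !orbT.
case/hasP => -[//|i] ain _; exists i.
have [s1 [s2 es]] : exists s1 s2, parrows p = s1 ++ inr i :: s2.
  by case/splitPr: ain => s1 s2; exists s1, s2.
apply/dividesP; exists s1, s2; split=> //.
have : is_walk (pstart p) (parrows p) := qpath_walk p.
by rewrite es is_walk_cat => /and3P[_ /eqP].
Qed.

Lemma has_loop_pcomp p p' r :
  pcomp p p' = Some r -> has_loop r = has_loop p || has_loop p'.
Proof. by case/pcompP => _ _ e; rewrite !has_loopE e has_cat. Qed.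

Lemma has_loop_old q : has_loop (old_path S q) = false.
Proof. by rewrite has_loopE; apply/hasPn => a /mapP[b _ ->]. Qed.

Lemma plen_old q : plen (old_path S q) = plen q.
Proof. exact: size_map. Qed.

(** On paths, the projection that kills the loops; [None] stands for zero. *)
Definition forget p : option (qpath Q) :=
  if has_loop p then None
  else insub ((pstart p, pmap (fun a => if a is inl b then Some b else None) (parrows p))
              : vertex Q * seq (arrow Q)).

Lemma old_pathK : pcancel (old_path S) forget.
Proof.
move=> q; rewrite /forget has_loop_old -[RHS](valK q) /=.
congr insub; rewrite [RHS]surjective_pairing; congr pair.
exact: map_pK.
Qed.

Lemma not_loopP p : ~~ has_loop p -> exists q, p = old_path S q.
Proof.
case: p => -[v s] w; rewrite has_loopE /parrows /= => nl.
have [s' [es ws]] : exists s', s = map (@old_arrow Q S) s' /\ is_walk (v : vertex Q) s'.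
  elim: s v w nl => [|[b|i] s IH] v //=; first by exists [::].
  move=> /andP[e /IH{}IH] /IH[s' [-> w]]; exists (b :: s'); split=> //=.
  by rewrite e.
exists (@QPath Q (v, s') ws); exact: qpathP.
Qed.

Lemma pcomp_old q q' :
  pcomp (old_path S q) (old_path S q') = omap (old_path S) (pcomp q q').
Proof.
have pe : pend (old_path S q) = pend q.
  by rewrite /pend /walk_end /parrows /= -map_comp.
case E: (pcomp q q') => [u|] /=.
  case/pcompP: E => e su au; apply/pcompP; split; rewrite ?pe //.
  by rewrite [LHS]/(map (@old_arrow Q S) (parrows u)) au; exact: map_cat.
apply: pcompN; rewrite pe => e.
by have [u] := @pcomp_ex Q q q' e; rewrite E.
Qed.

Lemma forget_pcomp p p' : obind forget (pcomp p p') =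
  obind (fun u => obind (pcomp u) (forget p')) (forget p).
Proof.
have lost r : has_loop r -> forget r = None by rewrite /forget => ->.
have [hp|/not_loopP[q ->]] := boolP (has_loop p).
  rewrite [in RHS](lost p) //=; case E: (pcomp p p') => [r|] //=.
  by apply: lost; rewrite (has_loop_pcomp E) hp.
rewrite old_pathK /=; have [hp|/not_loopP[q' ->]] := boolP (has_loop p').
  rewrite [in RHS](lost p') //=; case E: (pcomp _ p') => [r|] //=.
  by apply: lost; rewrite (has_loop_pcomp E) hp orbT.
rewrite old_pathK /= pcomp_old; case: (pcomp q q') => //= u.
exact: old_pathK.
Qed.

Definition Tu_divided p : Prop := exists2 t, Tu l t & divides t p.

Lemma Tu_divided_pcomp p a r :
  Tu_divided p -> pcomp a p = Some r \/ pcomp p a = Some r -> Tu_divided r.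
Proof. by move=> [t Tt d] c; exists t => //; apply: divides_pcomp c. Qed.

(** A path through both a loop and an arrow of [Q] changes from one kind to the
    other at some place, where it is divided by a relation of length two. *)
Lemma Tu_divided_mixed p :
  has_loop p -> ~~ all is_loop (parrows p) -> Tu_divided p.
Proof.
case: p => -[v s] w; rewrite has_loopE /parrows /= => h na.
have [s1 [x [y [s2 [es xy]]]]] := has_change h na.
have /and4P[_ /eqP ex /eqP ey _] :
  [&& is_walk v s1, @source QS x == walk_end v s1, @source QS y == @target QS x &
      is_walk (@target QS y) s2].
  by have := w; rewrite /= es (@is_walk_cat QS).
have [t Et] := @pcomp_ex QS (@arrow_path QS x) (@arrow_path QS y) (esym ey).
have [_ st at_] := (pcompP _ _ _).1 Et.
exists t.
  case: x y xy {es ex ey st at_} Et => [c|i] [d|j] //= _ Et.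
  - by exists j; constructor 2; exists c.
  - by exists i; constructor 3; exists d.
by apply/dividesP; exists s1, s2; rewrite at_ st.
Qed.

Lemma loop_walk (i : {i | S i}) n : is_walk (Q := QS) (val i) (nseq n (inr i)).
Proof. by elim: n => //= n ->; rewrite eqxx. Qed.

Definition loop_power (i : {i | S i}) n : qpath QS :=
  @QPath QS (val i, nseq n (inr i)) (loop_walk i n).

Lemma all_loop_walk (i : {i | S i}) (s : seq (arrow QS)) :
  is_walk (Q := QS) (val i) s -> all is_loop s -> s = nseq (size s) (inr i).
Proof.
elim: s => //= -[b|j] s IH //= /andP[/eqP/val_inj ji].
by rewrite ji => w al; congr cons; apply: IH.
Qed.

Lemma all_loopP p : has_loop p -> all is_loop (parrows p) ->
  exists i, p = loop_power i (plen p).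
Proof.
rewrite has_loopE => h al; have w : is_walk (pstart p) (parrows p) := qpath_walk p.
have [i pi] : exists i : {i | S i}, pstart p = val i.
  case: (parrows p) h al w => [|[b|i] s] // _ _ /andP[/eqP e _].
  by exists i; rewrite -e.
exists i; apply: qpathP => //.
by apply: all_loop_walk => //; rewrite -pi.
Qed.

(** Loops at different vertices do not compose, so a path made of loops only is
    a power of one of them. *)
Lemma Tu_divided_long p : has_loop p -> (l <= plen p)%N -> Tu_divided p.
Proof.
move=> hp lp; have [al|] := boolP (all is_loop (parrows p)); last exact: Tu_divided_mixed.
have [i pE] := all_loopP hp al.
exists (loop_power i l); first by exists i; constructor 1.
apply/dividesP; exists [::], (nseq (plen p - l) (inr i)); rewrite {1 3}pE.
by split=> //; rewrite /= -nseqD subnKC.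
Qed.

Lemma loop_power_not_divided i n : (n < l)%N -> ~ Tu_divided (loop_power i n).
Proof.
move=> nl [t Tt /dividesP[s1 [s2 [E _]]]].
have mem a : a \in parrows t -> a = inr i.
  move=> at_; have : a \in parrows (loop_power i n).
    by rewrite E !mem_cat at_ orbT.
  by rewrite mem_nseq => /andP[_ /eqP].
case: Tt => j [[_ tE]|[c /pcompP[_ _ tE]]|[d /pcompP[_ _ tE]]].
- move: nl; rewrite ltnNge => /negP; apply.
  have /(congr1 size) : nseq n (inr i) = s1 ++ nseq l (inr j) ++ s2 by rewrite -tE -E.
  by rewrite !size_cat !size_nseq => ->; rewrite addnCA leq_addr.
- by have := mem (inl c); rewrite tE mem_head => /(_ isT).
- by have := mem (inl d); rewrite tE !inE eqxx orbT => /(_ isT).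
Qed.

Lemma Tu_has_loop (t : qpath QS) : (vertex Q -> (0 < l)%N) -> Tu l t -> has_loop t.
Proof.
move=> l_gt0 [i]; rewrite has_loopE.
move=> [[_ ->]|[c /pcompP[_ _ ->]]|[d /pcompP[_ _ ->]]] //.
by case: l (l_gt0 (val i)).
Qed.
End Loops.

(** * The two homomorphisms between path algebras *)

Local Notation inclusion k S := (path_map (k := k) (fun q => Some (old_path S q))).
Local Notation restriction k S := (path_map (k := k) (@forget _ S)).

Section InclusionRestriction.
Variables (k : fieldType) (Q : quiver) (S : pred (vertex Q)).
Local Notation QS := (add_loops S).
Local Notation kQ := (path_algebra k Q).
Local Notation kQS := (path_algebra k QS).
Local Notation inclusion := (inclusion k S).
Local Notation restriction := (restriction k S).

Lemma path_inclE (x : kQ) : path_incl S x = inclusion x.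
Proof. by []. Qed.

Lemma inclusion_elt q : inclusion (path_elt k q) = path_elt k (old_path S q).
Proof. exact: path_map_elt. Qed.

Lemma restriction_elt (p : qpath QS) :
  restriction (path_elt k p) = opath_elt k (forget p).
Proof. exact: path_map_elt. Qed.

Lemma restriction_old q : restriction (path_elt k (old_path S q)) = path_elt k q.
Proof. by rewrite restriction_elt old_pathK. Qed.

Lemma old_trivial i : old_path S (trivial_path i) = @trivial_path QS i.
Proof. exact: qpathP. Qed.

Lemma old_arrow_path a : old_path S (arrow_path a) = arrow_path (old_arrow S a).
Proof. exact: qpathP. Qed.

Lemma inclusion_morphism : monoid_morphism inclusion.
Proof.
apply: path_map_monoid_morphism => [|p q /=].
  rewrite [LHS]linear_sum; apply: eq_bigr => i _.
  by rewrite /= inclusion_elt old_trivial.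
by rewrite pcomp_old; case: (pcomp p q).
Qed.

Lemma restriction_morphism : monoid_morphism restriction.
Proof.
apply: path_map_monoid_morphism; last exact: forget_pcomp.
rewrite [LHS]linear_sum; apply: eq_bigr => i _.
by rewrite /= -old_trivial restriction_old.
Qed.

Lemma inclusionK : cancel inclusion restriction.
Proof.
move=> x; rewrite [RHS]pathalgE [inclusion x]/path_map linear_sum.
by apply: eq_bigr => p _; rewrite linearZ /= restriction_old.
Qed.

Lemma path_partE (P : pred (qpath QS)) (w : kQS) :
  w = path_part P w + path_part (predC P) w.
Proof. by rewrite {1}[w]pathalgE (bigID P). Qed.

Lemma occurs_path_part (P : pred (qpath QS)) (w : kQS) p :
  occurs p (path_part P w) <-> P p /\ occurs p w.
Proof.
have part R r : occurs r (path_part R w) -> R r /\ occurs r w.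
  by move=> /occurs_sum[r' [/occurs_supp o Rr /occursZ /occurs_path_elt ->]].
split=> [|[Pp]]; first exact: part.
by rewrite {1}(path_partE P w) => /occursD[//|/part[/negP]].
Qed.

Lemma part_notBE (w : kQS) : part_notB w = inclusion (restriction w).
Proof.
rewrite [restriction w]/path_map linear_sum /part_notB /path_part big_mkcond.
apply: eq_bigr => p _; rewrite linearZ /=.
case: ifPn => [/not_loopP[q ->]|]; first by rewrite old_pathK /= inclusion_elt.
by rewrite negbK /forget => -> /=; rewrite linear0 scaler0.
Qed.

Lemma occurs_inclusion (x : kQ) p :
  occurs p (inclusion x) -> exists2 q, p = old_path S q & occurs q x.
Proof.
move=> /occurs_sum[q [/occurs_supp o _ /occursZ /occurs_path_elt ->]].
by exists q.
Qed.

Lemma occurs_restriction (w : kQS) q :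
  occurs (old_path S q) w -> occurs q (restriction w).
Proof.
move=> o; have : occurs (old_path S q) (part_notB w).
  by apply/occurs_path_part; rewrite /= has_loop_old.
rewrite part_notBE => /occurs_inclusion[q' e].
by rewrite (pcan_inj (@old_pathK Q S) e).
Qed.

Lemma long_inclusion t (x : kQ) : long t x -> long t (inclusion x).
Proof. by move=> Lx p /occurs_inclusion[q -> /Lx]; rewrite plen_old. Qed.
End InclusionRestriction.

(** * The uniformization *)

Section Uniformization.
Variables (k : fieldType) (Q : quiver) (I : ideal (path_algebra k Q)) (l : nat).
Hypotheses (admI : admissible I) (loewyI : is_alg_loewy_length (quiver_algebra I) l).
Local Notation S := (short_vertex I l).
Local Notation QS := (unif_quiver I l).
Local Notation kQ := (path_algebra k Q).
Local Notation kQS := (path_algebra k QS).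
Local Notation Istar := (unif_ideal I l).
Local Notation inclusion := (inclusion k S).
Local Notation restriction := (restriction k S).

Lemma admissible_long : ideal_set I `<=` long 2.
Proof. by case: admI => m _ [_ I2]; rewrite -arrow_ideal_exp. Qed.

Lemma admissible_long1 : ideal_set I `<=` long 1.
Proof. by move=> x /admissible_long; apply: long_le. Qed.

Lemma radical_exp t :
  set_exp (jacobson (R := quiver_algebra I)) t = quot_proj I @` long t.
Proof.
case: admI => m _ [mI _]; apply: (jacobson_exp admissible_long1 (m := m)).
by rewrite -arrow_ideal_exp.
Qed.

Lemma loewy_long : long l `<=` ideal_set I.
Proof.
move=> x Lx; apply/quot_proj_eq0.
rewrite -[LHS]mulr1; apply: loewyI.1; last by [].
by rewrite radical_exp; exists x.
Qed.

(** Only the quiver without vertices yields Loewy length zero; otherwise [l = 0]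
    would put every trivial path in [I]. *)
Lemma loewy_gt0 : vertex Q -> (0 < l)%N.
Proof.
move=> i; rewrite lt0n; apply/eqP => l0.
have : ideal_set I (path_elt k (trivial_path i)).
  by apply: loewy_long; rewrite l0 long0.
move/admissible_long/(_ (trivial_path i)) => lt.
by have : (2 <= plen (trivial_path i))%N by apply: lt; apply/occurs_path_elt.
Qed.

Lemma Istar_inclusion x : ideal_set I x -> ideal_set Istar (inclusion x).
Proof. by move=> Ix J; apply; left; exists x. Qed.

Lemma Istar_Tu_divided (p : qpath QS) :
  @Tu_divided Q S l p -> ideal_set Istar (path_elt k p).
Proof.
move=> [t Tt [p1 [p2]]]; case E: (pcomp p1 t) => [u|] //= E2.
have -> : path_elt k p = path_elt k p1 * path_elt k t * path_elt k p2.
  by rewrite path_eltM E /= path_eltM E2.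
by case: (ideal_setP Istar) => _ _; apply=> J; apply; right; exists t.
Qed.

(** The candidate for [I^*]. The part of [w] avoiding the loops is expressed by
    [restriction w], because [restriction] is multiplicative. *)
Definition star_set : set kQS :=
  [set w | ideal_set I (restriction w) /\
           forall p, occurs p w -> has_loop p -> @Tu_divided Q S l p].

Lemma star_set_long1 : star_set `<=` long 1.
Proof.
move=> w [Iw _] p o; have [|/not_loopP[q pq]] := boolP (has_loop p).
  by rewrite has_loopE /plen; case: (parrows p).
rewrite pq plen_old; apply: admissible_long1 Iw _ _.
by apply: occurs_restriction; rewrite -pq.
Qed.

(** Multiplying a path of positive length in [Q] by a path through a loop
    produces a path of mixed kind; as the paths occurring in elements of [I]
    have positive length, such products are accounted for by [T_u]. *)
Lemma is_ideal_star_set : is_ideal star_set.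
Proof.
have [RS1 RSM] := restriction_morphism k S.
split=> [|x y [Ix Tx] [Iy Ty]|a b x [Ix Tx]].
- split=> [|p]; last by rewrite /occurs mcoeff0 eqxx.
  by rewrite linear0; case: (ideal_setP I).
- split=> [|p /occursD[/Tx|/Ty] //].
  have -> : restriction (x + y) = restriction x + restriction y by exact: linearD.
  by case: (ideal_setP I) => _ ID _; apply: ID.
split.
  by rewrite !RSM; case: (ideal_setP I) => _ _; apply.
move=> r /occursM[u [p2 [/occursM[p1 [q [_ oq E]]] _ E2]]] hr.
have [hq|] := boolP (has_loop q).
  apply: (Tu_divided_pcomp (p := u)); last by right; exact: E2.
  apply: (Tu_divided_pcomp (p := q)); last by left; exact: E.
  exact: Tx.
move/not_loopP => [q' qE]; apply: Tu_divided_mixed => //.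
have lq : (1 <= plen q')%N.
  by apply: (admissible_long1 Ix); apply: occurs_restriction; rewrite -qE.
have [_ _ uE] := (pcompP _ _ _).1 E; have [_ _ rE] := (pcompP _ _ _).1 E2.
rewrite rE uE !all_cat qE.
have -> : all (@is_loop Q S) (parrows (old_path S q')) = false.
  move: lq; rewrite [parrows (old_path S q')]/(map (@old_arrow Q S) (parrows q')) /plen.
  by case: (parrows q').
by rewrite andbF.
Qed.

Lemma Istar_star_set : ideal_set Istar = star_set.
Proof.
apply/seteqP; split=> w.
  move/(_ (Ideal is_ideal_star_set)); apply=> {w} _ [[x Ix <-]|[t Tt <-]].
    split; first by rewrite path_inclE inclusionK.
    by move=> p /occurs_inclusion[q -> _]; rewrite has_loop_old.
  split; last first.
    move=> p /occurs_path_elt -> _; exists t => //.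
    by apply/dividesP; exists [::], [::]; rewrite cats0.
  rewrite restriction_elt /forget (Tu_has_loop loewy_gt0 Tt) /=.
  by case: (ideal_setP I).
move=> [Iw Tw]; rewrite (path_partE (@has_loop Q S) w).
case: (ideal_setP Istar) => _ ID _; apply: ID.
  apply: ideal_of_occurs => p /occurs_path_part[hp o].
  by apply: Istar_Tu_divided; apply: Tw.
rewrite -[path_part _ w]/(part_notB w) part_notBE.
exact: Istar_inclusion.
Qed.

Lemma Istar_restriction w : ideal_set Istar w -> ideal_set I (restriction w).
Proof. by rewrite Istar_star_set => -[]. Qed.

Lemma Istar_long1 : ideal_set Istar `<=` long 1.
Proof. by rewrite Istar_star_set; apply: star_set_long1. Qed.

Lemma Istar_longl : long l `<=` ideal_set Istar.
Proof.
move=> w Lw; apply: ideal_of_occurs => p /Lw lp.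
have [hp|/not_loopP[q pq]] := boolP (has_loop p).
  by apply: Istar_Tu_divided; apply: Tu_divided_long.
rewrite pq -inclusion_elt; apply: Istar_inclusion; apply: loewy_long.
by apply: long_elt; rewrite -(plen_old S) -pq.
Qed.

(** This is the purpose of the added loops: at a short vertex the power
    [l - 1] of the loop survives in [kQ^*/I^*], and at the other vertices a
    combination of paths of length at least [l - 1] survives already in [kQ/I]. *)
Lemma long_ending_at (i : vertex Q) : exists2 y : kQS, long l.-1 y &
  ~ ideal_set Istar (y * path_elt k (trivial_path (i : vertex QS))).
Proof.
have l_gt0 := loewy_gt0 i.
have [Si|nSi] := boolP (S i).
  pose p : qpath QS := @loop_power Q S (exist _ i Si) l.-1.
  have pl : plen p = l.-1 by rewrite /plen size_nseq.
  have pi : pend p = i.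
    by rewrite /pend /walk_end /= map_nseq; elim: (l.-1).
  exists (path_elt k p); first by apply: long_elt; rewrite pl.
  rewrite path_eltM pcompp1 pi eqxx /= => Ip.
  have op : occurs p (path_elt k p) by apply/occurs_path_elt.
  have hp : has_loop p.
    by have := Istar_long1 Ip op; rewrite pl has_loopE has_nseq => ->.
  have [_ /(_ p op hp)] : star_set (path_elt k p) by rewrite -Istar_star_set.
  by apply: loop_power_not_divided; rewrite prednK.
have [_ lmin] : is_loewy_length (vertex_module I i) l by move: nSi; rewrite negbK => /asboolP.
have : ~ kills (set_exp (jacobson (R := quiver_algebra I)) l.-1) (vertex_module I i).
  by move/lmin; rewrite leqNgt prednK ?leqnn.
move=> nk; apply: contrapT => ny; apply: nk => a b.
rewrite radical_exp => -[x Lx <-] [c _ <-].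
have [v <-] := quot_proj_surj c.
transitivity (quot_proj I (x * (v * path_elt k (trivial_path i)))).
  by rewrite !rmorphM.
apply/quot_proj_eq0; apply: contrapT => nI; apply: ny.
exists (inclusion (x * v)).
  apply: long_inclusion; rewrite -[l.-1]addn0.
  by apply: longM => //; rewrite long0.
have [_ incM] := inclusion_morphism k S.
rewrite -old_trivial -inclusion_elt -incM => /Istar_restriction.
by rewrite inclusionK -mulrA.
Qed.

Lemma summand_loewy_star (N : set (quiver_algebra Istar)^o) :
  is_direct_summand N -> N <> [set 0] -> is_loewy_length N l.
Proof. exact: (summand_loewy Istar_long1 Istar_longl long_ending_at). Qed.

(** The regular module is a summand of itself, so only the zero algebra needs a
    separate argument. *)
Lemma loewy_star : is_alg_loewy_length (quiver_algebra Istar) l.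
Proof.
have [l0|l_neq0] := eqVneq l 0%N.
  have l_min n : (l <= n)%N by rewrite l0.
  split=> [a b|s _]; last exact: l_min.
  have [x <-] := quot_proj_surj a => _ _.
  rewrite (_ : quot_proj Istar x = 0) ?scale0r //; apply/quot_proj_eq0/Istar_longl.
  by move=> p _; apply: l_min.
apply: summand_loewy_star.
  exists [set 0]; split.
  - by split.
  - by split=> // a x y -> ->; rewrite scaler0 addr0.
  - by rewrite setTI.
  - by apply/seteqP; split=> // x _; exists x => //; exists 0; rewrite ?addr0.
(* A zero quotient by [I^*] forces [1] to be in [I], hence [l = 0]. *)
move=> eT; have I1 : ideal_set I 1.
  have [RS1 _] := restriction_morphism k S.
  rewrite -RS1; apply: Istar_restriction; apply/quot_proj_eq0.
  suff : [set: (quiver_algebra Istar)^o] (quot_proj Istar 1) by rewrite eT.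
  by [].
move: l_neq0; rewrite -leqn0 => /negP; apply; apply: loewyI.2 => a b _ _.
have [x <-] := quot_proj_surj a.
rewrite (_ : quot_proj I x = 0) ?scale0r //; apply/quot_proj_eq0.
by rewrite -[x]mulr1; apply/ideal_memP/ideal_mem_mull/ideal_memP.
Qed.
End Uniformization.

Theorem lemma4p11 (k : fieldType) (Q : quiver)
    (I : ideal (path_algebra k Q)) (l : nat) :
  admissible I ->
  is_alg_loewy_length (quiver_algebra I) l ->
  let S := short_vertex I l in
  let Istar := unif_ideal I l in
  let Lambda := quiver_algebra I in
  let Lambdastar := quiver_algebra Istar in
  (* (i) *)
  ((forall w : path_algebra k (unif_quiver I l),
      ideal_set Istar w <->
      [set path_incl S x | x in ideal_set I] (part_notB w) /\
      forall p, occurs p (part_B w) -> exists2 t, Tu l t & divides t p) /\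
   ideal_set Istar `&` range (path_incl S (k := k)) =
     [set path_incl S x | x in ideal_set I]) /\
  (* (ii) *)
  (uniform_loewy_length Lambdastar /\ is_alg_loewy_length Lambdastar l) /\
  (* (iii) *)
  exists (iota : {rmorphism Lambda -> Lambdastar})
         (pi : {rmorphism Lambdastar -> Lambda}),
    [/\ scalable iota /\ scalable pi,
        (forall i : vertex Q,
           iota (quot_proj I (path_elt k (trivial_path i))) =
           quot_proj Istar (path_elt k (trivial_path (i : vertex (unif_quiver I l))))) /\
        (forall a : arrow Q,
           iota (quot_proj I (path_elt k (arrow_path a))) =
           quot_proj Istar (path_elt k (arrow_path (old_arrow S a)))),
        [/\ (forall i : vertex Q,
               pi (quot_proj Istar
                     (path_elt k (trivial_path (i : vertex (unif_quiver I l))))) =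
               quot_proj I (path_elt k (trivial_path i))),
            (forall a : arrow Q,
               pi (quot_proj Istar (path_elt k (arrow_path (old_arrow S a)))) =
               quot_proj I (path_elt k (arrow_path a))) &
            (forall b : {i : vertex Q | S i},
               pi (quot_proj Istar (path_elt k (arrow_path (new_loop b)))) = 0)],
        injective iota /\ (forall y, exists x, pi x = y) &
        pi \o iota =1 id].
Proof.
move=> admI loewyI S Istar Lambda Lambdastar.
split; first split.
- move=> w; rewrite /Istar Istar_star_set //; split.
    move=> [Iw Tw]; split.
      by exists (restriction k S w) => //; rewrite part_notBE.
    by move=> p /occurs_path_part[hp o]; apply: Tw.
  move=> [[x Ix xE] Tw]; split; last first.
    by move=> p o hp; apply: Tw; apply/occurs_path_part.
  suff -> : restriction k S w = x by [].
  rewrite -[LHS](@inclusionK k Q S) -[RHS](@inclusionK k Q S).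
  by rewrite -part_notBE -xE.
- apply/seteqP; split=> [w [Iw [x _ xw]]|w [x Ix xw]].
    exists x => //; rewrite -[x](@inclusionK k Q S) -path_inclE xw.
    exact: Istar_restriction.
  by rewrite -xw; split; [exact: Istar_inclusion|exists x].
split.
  split; last exact: loewy_star.
  exists l; first exact: loewy_star.
  by move=> N sumN [_ N0 _]; apply: summand_loewy_star.
have [iota [iotaZ iotaE]] : exists g : {rmorphism Lambda -> Lambdastar},
    scalable g /\ forall x, g (quot_proj I x) = quot_proj Istar (inclusion k S x).
  exact: (quot_lift (inclusion_morphism k S) (@Istar_inclusion k Q I l)).
have [pi [piZ piE]] : exists g : {rmorphism Lambdastar -> Lambda},
    scalable g /\ forall x, g (quot_proj Istar x) = quot_proj I (restriction k S x).
  exact: (quot_lift (restriction_morphism k S) (Istar_restriction admI loewyI)).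
have piK : pi \o iota =1 id.
  move=> b; have [x <-] := quot_proj_surj b.
  by rewrite /= iotaE piE inclusionK.
exists iota, pi; split=> //.
- by split=> i; rewrite iotaE inclusion_elt ?old_trivial ?old_arrow_path.
- split=> i; rewrite piE.
  + by rewrite -old_trivial restriction_old.
  + by rewrite -old_arrow_path restriction_old.
  + rewrite restriction_elt /forget has_loopE /=.
    exact: rmorph0.
- split; first by apply: (can_inj (g := pi)) => x; apply: piK.
  by move=> y; exists (iota y); apply: piK.
Qed.
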